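(* Let $G$ be a countably compact infinite locally finite $T_1$ paratopological group without non-trivial convergent sequences. Then $G$ has no suitable set.
   Context: A paratopological group is a group $G$ endowed with a topology such that the group operation $G\times G\to G$ is continuous (inversion need not be continuous). The identity of $G$ is denoted by $e$. A subset $S$ of a paratopological group $G$ is a suitable set for $G$ if $S$ is a discrete subspace of $G$, $S\cup\{e\}$ is closed in $G$, and the subgroup $\langle S\rangle$ of $G$ generated by $S$ is dense in $G$. A space $X$ is countably compact if each infinite subset $A$ of $X$ has an accumulation point $x\in X$ (each neighborhood of $x$ contains infinitely many points of $A$); for the $T_1$ spaces considered this is equivalent to each countable open cover of $X$ having a finite subcover. A group is locally finite if each of its finitely generated subgroups is finite. A convergent sequence is non-trivial if it is not eventually constant. *)

(* Defs.v *)
From HB Require Import structures.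
From mathcomp Require Import all_boot.
From mathcomp Require Import all_classical topology.

Set Implicit Arguments.
Unset Strict Implicit.
Unset Printing Implicit Defensive.

Local Open Scope classical_set_scope.
Local Open Scope group_scope.

HB.mixin Record isParatopologicalGroup G of Topological G & Group G := {
  mulg_continuous : continuous (fun x : G * G => x.1 * x.2)
}.

#[short(type="paratopologicalGroupType")]
HB.structure Definition ParatopologicalGroup :=
  {G of Topological G & Group G & isParatopologicalGroup G}.

Definition generated_subgroup {G : groupType} (A : set G) : set G :=
  smallest (fun H : set G => group_closed (mem H)) A.

Definition locally_finite_group (G : groupType) : Prop :=
  forall A : set G, finite_set A -> finite_set (generated_subgroup A).

(* [limit_point] of the library only asks each neighbourhood of [x] to meet
   [A `\ x]; the two notions agree in T1 spaces. *)
Definition accumulation_point {X : topologicalType} (A : set X) (x : X) : Prop :=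
  forall U, nbhs x U -> infinite_set (A `&` U).

Definition countably_compact (X : topologicalType) : Prop :=
  forall A : set X, infinite_set A -> exists x, accumulation_point A x.

Definition eventually_constant {X : Type} (u : nat -> X) : Prop :=
  exists c, \forall n \near \oo, u n = c.

Definition no_nontrivial_convergent_sequence (X : topologicalType) : Prop :=
  forall (u : nat -> X) (x : X), u @ \oo --> x -> eventually_constant u.

(* The carrier of [subspace S] is all of [X], with the points outside [S] made
   isolated, so this only constrains the topology induced on [S]; see
   [discrete_subspaceP]. *)
Definition discrete_subspace {X : topologicalType} (S : set X) : Prop :=
  @nbhs (subspace S) (subspace S) = principal_filter.

Lemma discrete_subspaceP (X : topologicalType) (S : set X) :
  discrete_subspace S <-> S `<=` isolated S.
Proof.
split=> [dS x Sx|iS].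
  split; first exact/mem_set.
  have : nbhs_subspace (x : subspace S) [set x].
    by rewrite -[nbhs_subspace _]/(@nbhs _ (subspace S) x) dS; exact/principal_filterP.
  rewrite -nbhs_subspace_in // => xS.
  exists [set y | S y -> y = x]; first exact: xS.
  by apply/seteqP; split=> [y [/= + Sy]|y ->]; [apply|split].
apply/funext => x; rewrite -[LHS]/(nbhs_subspace x).
have [Sx|nSx] := pselect (S x); last by rewrite -nbhs_subspace_out.
rewrite -nbhs_subspace_in //; have [_ [V xV VS]] := iS x Sx.
apply/seteqP; split=> W.
  by move=> xW; apply/principal_filterP; exact: (nbhs_singleton xW).
move=> /principal_filterP Wx.
apply: filterS xV => y Vy Sy.
by have -> : y = x by have : (V `&` S) y by []; rewrite VS.
Qed.

Definition suitable_set {G : paratopologicalGroupType} (S : set G) : Prop :=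
  [/\ discrete_subspace S,
      closed (S `|` [set 1]) &
      dense (generated_subgroup S)].

(* Main.v *)
Require Import Defs.
From mathcomp Require Import all_boot.
From mathcomp Require Import all_classical topology.

Local Open Scope classical_set_scope.

(** If [S] is suitable and infinite, countable compactness and discreteness make
  the identity the only accumulation point of every infinite subset of [S], so
  any enumeration of distinct elements of [S] is a non-trivial sequence
  converging to the identity. If [S] is finite, it generates a finite subgroup,
  which is closed since [G] is T1 and so cannot be dense in the infinite [G]. *)

Lemma near_infty_notin_finite (A : set nat) :
  finite_set A -> \forall n \near \oo, ~ A n.
Proof.
move=> /finite_seqP[s ->]; exists (\max_(i <- s) i).+1 => // n /= + ns.
by rewrite ltnNge (@leq_bigmax_seq _ s xpredT id).
Qed.

Lemma infinite_set_sequence (T : Type) (A : set T) :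
  infinite_set A -> exists2 u : nat -> T, injective u & forall n, A (u n).
Proof.
move=> /infiniteP/card_leP[f].
(* [f] injects the subtype of [[set: nat]] into that of [A], so [n] is packed before and the value
   unpacked after. *)
exists (fun n => set_val (f (SigSub (mem_setT n)))) => [m n /val_inj|n].
  by move=> /(@inj _ _ _ f); rewrite !in_setT => /(_ isT isT) [].
exact: set_valP.
Qed.

Lemma eventually_constant_not_injective (X : Type) (u : nat -> X) :
  eventually_constant u -> ~ injective u.
Proof.
move=> [c [N _ uc]] /(_ N N.+1); rewrite (uc N) ?(uc N.+1) /= //.
by move=> /(_ erefl) /eqP; rewrite (ltn_eqF (ltnSn N)).
Qed.

Lemma accumulation_point_closure (X : topologicalType) (A : set X) (x : X) :
  accumulation_point A x -> closure A x.
Proof. by move=> Ax U /Ax /infinite_setN0. Qed.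

Lemma accumulation_pointS (X : topologicalType) (A B : set X) (x : X) :
  A `<=` B -> accumulation_point A x -> accumulation_point B x.
Proof. by move=> AB Ax U /Ax + fin; apply; apply: sub_finite_set fin; exact: setSI. Qed.

Lemma discrete_subspace_not_accumulation_point (X : topologicalType)
    (S : set X) (x : X) :
  discrete_subspace S -> S x -> ~ accumulation_point S x.
Proof.
move=> /discrete_subspaceP/[apply] -[_ [V xV VS]] /(_ V xV).
(* The isolating neighbourhood [V] meets [S] only in [x]. *)
by rewrite setIC VS; apply; exact: finite_set1.
Qed.

(** If [S] had infinitely many points outside [U], they would accumulate at some [y] in the closed
    set [S] with [x] added; discreteness leaves only [y = x]. *)
Lemma finite_setD_nbhs (X : topologicalType) (S : set X) (x : X) :
  countably_compact X -> discrete_subspace S -> closed (S `|` [set x]) ->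
  forall U, nbhs x U -> finite_set (S `\` U).
Proof.
move=> ccX dS cS U xU; apply: contrapT => /[dup] infSU /ccX[y ySU].
have yS : accumulation_point S y by apply: accumulation_pointS ySU => z [].
have [Sy|yx] : (S `|` [set x]) y.
  apply/cS/accumulation_point_closure.
  by apply: accumulation_pointS yS; exact: subsetUl.
  exact: discrete_subspace_not_accumulation_point yS.
have /ySU : nbhs y U by rewrite yx.
(* [U] is itself a neighbourhood of [y] disjoint from [S] minus [U]. *)
by apply; rewrite setIC setDE setICA setICr setI0; exact: finite_set0.
Qed.

Lemma discrete_subspace_closed_setU1_finite (X : topologicalType)
    (S : set X) (x : X) :
  countably_compact X -> no_nontrivial_convergent_sequence X ->
  discrete_subspace S -> closed (S `|` [set x]) -> finite_set S.
Proof.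
move=> ccX noseq dS cS; apply: contrapT => /infinite_set_sequence[u u_inj uS].
apply: (eventually_constant_not_injective _ _ _ u_inj); apply: (noseq u x) => U xU.
(* Injectivity of [u] turns finitely many points outside [U] into finitely many indices. *)
have /near_infty_notin_finite : finite_set (u @^-1` (S `\` U)).
  apply: finite_preimage; first by move=> m n _ _ /u_inj.
  exact: finite_setD_nbhs xU.
apply: filterS => n nSU; apply: contrapT => nU; apply: nSU; split=> //.
Qed.

Lemma dense_closed (X : topologicalType) (A : set X) :
  dense A -> closed A -> A = setT.
Proof.
move=> denseA cA; apply/seteqP; split=> // x _; apply: contrapT => nAx.
by have [||y [] //] := denseA (~` A); [exists x|exact: closed_openC].
Qed.

Theorem proposition3p2 (G : paratopologicalGroupType)
    (G_countably_compact : countably_compact G)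
    (G_infinite : infinite_set [set: G])
    (G_locally_finite : locally_finite_group G)
    (G_T1 : accessible_space G)
    (G_no_seq : no_nontrivial_convergent_sequence G) :
  ~ exists S : set G, suitable_set S.
Proof.
move=> [S [dS cS denseS]].
have /G_locally_finite finS : finite_set S.
  exact: discrete_subspace_closed_setU1_finite cS.
(* Once closed, the dense finite subgroup is all of [G]; its closedness remains to be shown. *)
apply: G_infinite; rewrite -(dense_closed _ _ denseS) //.
exact: (accessible_finite_set_closed.1 G_T1).
Qed.
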